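(* Let $S$ be a finite semigroup. The following are equivalent: (i) $S$ is a $B_2$-combinatorial semigroup; (ii) $S$ has a zero and, for every nonzero element $a$ of $S$, the principal factor $J(a)/I(a)$ is isomorphic to the semigroup $B_2$.
   Context: Semigroups are nonempty. A semilattice is a commutative semigroup all of whose elements are idempotent; a subsemilattice of a semigroup $S$ is a subsemigroup that is a semilattice. A semigroup $S$ is semilattice indecomposable (s-indecomposable) if every semilattice homomorphic image of $S$ has exactly one element. A semigroup $S$ is called $B_2$-combinatorial if $S$ is s-indecomposable, $|S|=4k+1$ for some nonnegative integer $k$, and $S$ has a subsemilattice $Y$ with $|Y|=2\left\lfloor\frac{|S|-1}{4}\right\rfloor+1=\frac{|S|+1}{2}=2k+1$. $B_2$ is the $5$-element Brandt semigroup $\mathcal{M}^0(1;2,2;I)$, i.e. the set of elements $(i,j)$ with $i,j\in\{1,2\}$ together with a zero $0$, with multiplication $(i,j)(k,l)=(i,l)$ if $j=k$ and $(i,j)(k,l)=0$ otherwise. For $a\in S$, $J(a)$ denotes the principal two-sided ideal of $S$ generated by $a$, and $I(a)=\{b\in J(a): J(b)\neq J(a)\}$, which is either empty or an ideal. The principal factor $J(a)/I(a)$ is the Rees factor semigroup obtained from $J(a)$ by collapsing $I(a)$ to a single zero element (it is $J(a)$ itself if $I(a)=\emptyset$). *)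

(* Defs.v *)
From HB Require Import structures.
From mathcomp Require Import all_boot.

Set Implicit Arguments.
Unset Strict Implicit.
Unset Printing Implicit Defensive.

Import Algebra.

Local Open Scope group_scope.

#[short(type="finSemigroupType")]
HB.structure Definition FinSemigroup := {S of Semigroup S & Finite S}.

Definition isomorphic (S T : semigroupType) : Prop :=
  exists f : {multiplicative S -> T}, bijective f.

Definition is_zero (S : semigroupType) (z : S) : Prop :=
  forall x : S, z * x = z /\ x * z = z.

Definition semilattice (T : semigroupType) : Prop :=
  (forall x y : T, x * y = y * x) /\ (forall x : T, x * x = x).

Definition s_indecomposable (S : semigroupType) : Prop :=
  forall (T : semigroupType) (f : {multiplicative S -> T}),
    semilattice T -> (forall t : T, exists s : S, f s = t) ->
    exists t : T, forall t' : T, t' = t.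

Definition subsemilattice (S : finSemigroupType) (Y : {set S}) : Prop :=
  [/\ Y != set0, mulg_closed Y, {in Y &, forall x y, x * y = y * x}
    & {in Y, forall x, x * x = x}].

Definition B2_combinatorial (S : finSemigroupType) : Prop :=
  [/\ s_indecomposable S,
      exists k : nat, #|S| = (4 * k + 1)%N
    & exists2 Y : {set S}, subsemilattice Y &
        #|Y| = (2 * ((#|S| - 1) %/ 4) + 1)%N].

(* [None] is the zero of B_2 and [Some (i, j)] is the element (i, j). *)
Definition B2 : Type := option ('I_2 * 'I_2).

HB.instance Definition _ := Finite.on B2.

Definition B2_mul (x y : B2) : B2 :=
  match x, y with
  | Some (i, j), Some (k, l) => if j == k then Some (i, l) else None
  | _, _ => None
  end.

Lemma B2_mulA : associative B2_mul.
Proof.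
case=> [[i j]|] [[k l]|] [[m n]|] //=.
- by case jk: (j == k); case lm: (l == m); rewrite /= ?jk ?lm.
- by case: (j == k).
Qed.

HB.instance Definition _ := isSemigroup.Build B2 B2_mulA.

Section PrincipalFactor.

Variable S : finSemigroupType.
Implicit Types (a b c : S) (A : {set S}).

Definition ideal A : bool :=
  [&& A != set0, [forall s, forall x in A, s * x \in A]
    & [forall s, forall x in A, x * s \in A]].

Definition principal_ideal a : {set S} :=
  \bigcap_(A : {set S} | ideal A && (a \in A)) A.

Definition lower_ideal a : {set S} :=
  [set b in principal_ideal a | principal_ideal b != principal_ideal a].

Lemma mem_principal_ideal a : a \in principal_ideal a.
Proof. by apply/bigcapP => A /andP[]. Qed.

Lemma principal_idealMl a s b :
  b \in principal_ideal a -> s * b \in principal_ideal a.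
Proof.
move=> /bigcapP bJ; apply/bigcapP => A HA; have bA := bJ A HA.
case/andP: HA => /and3P[_ /forallP/(_ s)/forallP/(_ b) H _] _.
exact: (implyP H).
Qed.

Lemma principal_idealMr a s b :
  b \in principal_ideal a -> b * s \in principal_ideal a.
Proof.
move=> /bigcapP bJ; apply/bigcapP => A HA; have bA := bJ A HA.
case/andP: HA => /and3P[_ _ /forallP/(_ s)/forallP/(_ b) H] _.
exact: (implyP H).
Qed.

Lemma ideal_principal_ideal a : ideal (principal_ideal a).
Proof.
apply/and3P; split.
- by apply/set0Pn; exists a; apply: mem_principal_ideal.
- by apply/forallP => s; apply/forall_inP => x; apply: principal_idealMl.
- by apply/forallP => s; apply/forall_inP => x; apply: principal_idealMr.
Qed.

Lemma principal_idealS a b :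
  b \in principal_ideal a -> principal_ideal b \subset principal_ideal a.
Proof.
by move=> bJ; apply: bigcap_inf; rewrite ideal_principal_ideal bJ.
Qed.

Lemma lower_ideal_sub a b c : b \in lower_ideal a ->
  c \in principal_ideal b -> c \in lower_ideal a.
Proof.
rewrite !inE => /andP[bJ bNa] cJ; have sba := principal_idealS bJ.
rewrite (subsetP sba) //=; apply: contra bNa => /eqP eca.
by rewrite eqEsubset sba -eca principal_idealS.
Qed.

Lemma lower_idealMl a s b : b \in lower_ideal a -> s * b \in lower_ideal a.
Proof.
by move=> /lower_ideal_sub; apply; rewrite principal_idealMl ?mem_principal_ideal.
Qed.

Lemma lower_idealMr a s b : b \in lower_ideal a -> b * s \in lower_ideal a.
Proof.
by move=> /lower_ideal_sub; apply; rewrite principal_idealMr ?mem_principal_ideal.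
Qed.

Variable a : S.

Definition principal_ideal_type : Type := {x : S | x \in principal_ideal a}.

HB.instance Definition _ := SubFinite.copy principal_ideal_type
  {x : S | x \in principal_ideal a}.

Lemma principal_ideal_mulg_closed : mulg_closed (principal_ideal a).
Proof. by move=> x y _; apply: principal_idealMl. Qed.

HB.instance Definition _ :=
  SubChoice_isSubSemigroup.Build S _ principal_ideal_type
    principal_ideal_mulg_closed.

(* The Rees congruence: equality when [lower_ideal a] is empty, so that the
   quotient is then (a copy of) the principal ideal itself. *)
Definition rees_rel (u v : principal_ideal_type) : bool :=
  (u == v) || ((val u \in lower_ideal a) && (val v \in lower_ideal a)).

Lemma rees_rel_refl : reflexive rees_rel.
Proof. by move=> u; rewrite /rees_rel eqxx. Qed.

Lemma rees_rel_sym : symmetric rees_rel.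
Proof. by move=> u v; rewrite /rees_rel eq_sym andbC. Qed.

Lemma rees_rel_trans : transitive rees_rel.
Proof.
move=> v u w /orP[/eqP-> // | /andP[uI vI]] /orP[/eqP<- | /andP[_ wI]];
  by rewrite /rees_rel uI ?vI ?wI orbT.
Qed.

Canonical rees_equiv :=
  EquivRel rees_rel rees_rel_refl rees_rel_sym rees_rel_trans.

Definition principal_factor : Type := {eq_quot rees_rel}%qT.

HB.instance Definition _ := Choice.on principal_factor.
HB.instance Definition _ := EqQuotient.on principal_factor.

Definition principal_factor_mul : principal_factor -> principal_factor ->
  principal_factor := lift_op2 principal_factor *%g.

Lemma pi_principal_factor_mul :
  {morph \pi_principal_factor%qT : u v / u * v >-> principal_factor_mul u v}.
Proof.
move=> u v; unlock principal_factor_mul; apply/eqmodP => /=.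
have /eqmodP /= := reprK (\pi_principal_factor%qT u).
have /eqmodP /= := reprK (\pi_principal_factor%qT v).
set u' := repr _; set v' := repr _; rewrite /rees_rel !valM.
case/orP=> [/eqP-> | /andP[v'I vI]] /orP[/eqP-> | /andP[u'I uI]].
- by rewrite eqxx.
- by rewrite !lower_idealMr ?orbT.
- by rewrite !lower_idealMl ?orbT.
- by rewrite !lower_idealMl ?orbT.
Qed.

Lemma principal_factor_mulA : associative principal_factor_mul.
Proof.
elim/quotW=> u; elim/quotW=> v; elim/quotW=> w.
by rewrite -!pi_principal_factor_mul mulgA.
Qed.

HB.instance Definition _ :=
  isSemigroup.Build principal_factor principal_factor_mulA.

End PrincipalFactor.

(* Main.v *)
Require Import Defs.
From mathcomp Require Import all_boot.
From HB Require Import structures.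
From mathcomp Require Import zify.

Import Algebra.

(** Both conditions are statements about the J-classes of [S], the classes of
elements generating the same principal ideal: condition (ii) says that every
J-class but that of the zero consists of four elements multiplying like the
nonzero elements of B_2, up to strictly lower J-classes.  Such a family is
recorded here by [matrix_units], and [isomorphicP] identifies it with an
isomorphism of the principal factor onto B_2.

From (i) to (ii), the subsemilattice [Y] is compared with [S] inside each
J-class.  Two distinct commuting idempotents of one J-class have their product
strictly below it, so [m] commuting idempotents of a J-class span [m ^ 2]
matrix units there ([matrix_units_exist]) and the class has at least [m ^ 2]
elements.  This is at least [2 * m] except for [m = 1].  Semilattice
indecomposability enters through [closed_jclass_min]: a J-class closed under
product that contains an idempotent lies below every other one, for otherwise
the elements above it would form a proper subsemigroup with an ideal as
complement, and [S] would map onto the two-element semilattice.  A J-class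
that meets [Y] and is not the minimum is thus not closed, and then has at least
three elements ([small_jclass_closed]); the minimum contains at most one element
of [Y].  So [2 * m] exceeds the size of a J-class at most for the class of a
zero, and there only by one.  Since [2 * #|Y| = #|S| + 1], a zero exists and
equality holds in all the other classes, which leaves only [m = 2] with four
elements, that is, a full set of 2 x 2 matrix units.

From (ii) to (i), the matrix units make [S] an inverse semigroup, whose
idempotents therefore commute ([idem_commute]).  Each nonzero J-class has four
elements, two of them idempotent, which gives both cardinalities with [Y] the
set of all idempotents.  A homomorphism [f] to a semilattice is constant on each
J-class, and the diagonal units of a nonzero class multiply to something
strictly lower, so by descent [f] takes everywhere the value it has at the
zero. *)

(** The two-element semilattice, named apart from [bool] so that its product is
the meet. *)
Definition bool_meet : Type := bool.

HB.instance Definition _ := Choice.on bool_meet.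

HB.instance Definition _ := isSemigroup.Build bool_meet andbA.

Section FiniteSemigroup.

Local Set Implicit Arguments.
Local Unset Strict Implicit.
Local Open Scope group_scope.

Variable S : finSemigroupType.
Implicit Types (a b c e f s t x y z : S) (Y : {set S}).

Local Notation J := principal_ideal.

(** * Principal ideals and J-classes *)

Lemma principal_idealP a b :
  reflect [\/ b = a, exists x, b = x * a, exists y, b = a * y
             | exists x y, b = x * a * y]
          (b \in J a).
Proof.
apply: (iffP idP) => [/bigcapP bJ | ]; last first.
  case=> [-> | [x ->] | [y ->] | [x [y ->]]].
  - exact: mem_principal_ideal.
  - by rewrite principal_idealMl ?mem_principal_ideal.
  - by rewrite principal_idealMr ?mem_principal_ideal.
  - by rewrite principal_idealMr // principal_idealMl ?mem_principal_ideal.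
pose P b := [|| b == a, [exists x, b == x * a], [exists y, b == a * y]
              | [exists x, exists y, b == x * a * y]].
have PP c : reflect [\/ c = a, exists x, c = x * a, exists y, c = a * y
             | exists x y, c = x * a * y] (P c).
  apply: (iffP or4P) => -[].
  - by move/eqP; constructor 1.
  - by case/existsP=> x /eqP; constructor 2; exists x.
  - by case/existsP=> x /eqP; constructor 3; exists x.
  - by case/existsP=> x /existsP[y] /eqP; constructor 4; exists x, y.
  - by move/eqP; constructor 1.
  - by case=> x /eqP cE; constructor 2; apply/existsP; exists x.
  - by case=> x /eqP cE; constructor 3; apply/existsP; exists x.
  - case=> x [y /eqP cE]; constructor 4.
    by apply/existsP; exists x; apply/existsP; exists y.
suff: b \in [set c | P c] by rewrite inE => /PP.
apply: bJ; rewrite inE [P a]/P eqxx andbT; apply/and3P; split.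
- by apply/set0Pn; exists a; rewrite inE /P eqxx.
- apply/forallP=> s; apply/forall_inP=> c; rewrite !inE => /PP cP; apply/PP.
  case: cP => [-> | [x ->] | [y ->] | [x [y ->]]].
  + by constructor 2; exists s.
  + by constructor 2; exists (s * x); rewrite mulgA.
  + by constructor 4; exists s, y; rewrite mulgA.
  + by constructor 4; exists (s * x), y; rewrite !mulgA.
- apply/forallP=> s; apply/forall_inP=> c; rewrite !inE => /PP cP; apply/PP.
  case: cP => [-> | [x ->] | [y ->] | [x [y ->]]].
  + by constructor 3; exists s.
  + by constructor 4; exists x, s.
  + by constructor 3; exists (y * s); rewrite mulgA.
  + by constructor 4; exists x, (y * s); rewrite !mulgA.
Qed.

Lemma principal_ideal_trans b a c : a \in J b -> b \in J c -> a \in J c.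
Proof. by move=> ab /principal_idealS /subsetP; apply. Qed.

Lemma mulg_ideall a b : a * b \in J a.
Proof. by rewrite principal_idealMr ?mem_principal_ideal. Qed.

Lemma mulg_idealr a b : a * b \in J b.
Proof. by rewrite principal_idealMl ?mem_principal_ideal. Qed.

Definition jclass a : {set S} := [set b | J b == J a].

Lemma jclassP a b : reflect (b \in J a /\ a \in J b) (b \in jclass a).
Proof.
rewrite inE; apply: (iffP eqP) => [baE | [ba ab]].
  by split; [rewrite -baE | rewrite baE]; apply: mem_principal_ideal.
by apply/eqP; rewrite eqEsubset !principal_idealS.
Qed.

Lemma jclass_sub a b : b \in jclass a -> b \in J a.
Proof. by case/jclassP. Qed.

Lemma jclass_refl a : a \in jclass a.
Proof. by rewrite inE. Qed.

Lemma jclass_eq a b : b \in jclass a -> jclass b = jclass a.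
Proof. by move=> ba; apply/setP=> c; move: ba; rewrite !inE => /eqP->. Qed.

Lemma card_jclass_gt0 a : 0 < #|jclass a|.
Proof. by apply/card_gt0P; exists a; apply: jclass_refl. Qed.

Lemma lower_idealE a b :
  (b \in lower_ideal a) = (b \in J a) && (b \notin jclass a).
Proof. by rewrite !inE. Qed.

Lemma card_by_jclass Y :
  #|Y| = \sum_(I in [set J a | a : S]) #|[set b in Y | J b == I]|.
Proof.
rewrite -sum1_card.
rewrite (partition_big (fun b => J b) (mem [set J a | a : S])) /=.
  by apply: eq_bigr => I _; rewrite -sum1dep_card.
by move=> b _; apply: imset_f.
Qed.

Lemma zero_ideal z b : is_zero z -> b \in J z -> b = z.
Proof.
move=> z0 /principal_idealP[// | [x ->] | [y ->] | [x [y ->]]].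
- by have [_ ->] := z0 x.
- by have [-> _] := z0 y.
- by have [_ ->] := z0 x; have [-> _] := z0 y.
Qed.

Lemma jclass_zero z : is_zero z -> jclass z = [set z].
Proof.
move=> z0; apply/setP=> b; rewrite in_set1; apply/jclassP/eqP => [[bz _]|->].
  exact: zero_ideal.
by rewrite mem_principal_ideal.
Qed.

(** * Idempotents *)

(** Because [e] is idempotent, factors on both sides can be found even when
[e] is [s] or a one-sided multiple of it, and they can be taken in [e * S] and
[S * e]. *)
Lemma idem_above e s : e * e = e -> e \in J s ->
  exists x y, [/\ x * s * y = e, e * x = x & y * e = y].
Proof.
move=> ee /principal_idealP es.
have [x [y xsy]]: exists x y, x * s * y = e.
  case: es => [<- | [x eE] | [y eE] | [x [y eE]]].
  - by exists e, e; rewrite !ee.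
  - by exists x, e; rewrite -eE.
  - by exists e, y; rewrite -mulgA -eE.
  - by exists x, y.
exists (e * x), (y * e); split; last 2 first.
- by rewrite mulgA ee.
- by rewrite -mulgA ee.
by rewrite !mulgA -2!(mulgA e) -mulgA xsy mulgA !ee.
Qed.

Lemma idem_below e s : e * e = e -> s \in J e ->
  exists x y, [/\ s = x * y, x * e = x & e * y = y].
Proof.
move=> ee /principal_idealP[-> | [x ->] | [y ->] | [x [y ->]]].
- by exists e, e; rewrite !ee.
- by exists (x * e), e; rewrite -!mulgA !ee.
- by exists e, (e * y); rewrite !mulgA !ee.
- by exists (x * e), (e * y); rewrite !mulgA -!(mulgA _ e e) !ee.
Qed.

(** Stability of finite semigroups: from [e = r * (e * q) * s], left
multiplication by [r] sends [e * q * S] onto a set containing [e * S], so the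
inclusion of [e * q * S] in [e * S] is an equality by cardinality. *)
Lemma idem_stable e q : e * e = e -> e \in J (e * q) ->
  exists t, e = e * q * t.
Proof.
move=> ee /(idem_above ee)[r [s [rqs _ _]]].
pose A : {set S} := [set e * t | t in S].
pose B : {set S} := [set e * q * t | t in S].
have BA : B \subset A.
  apply/subsetP=> _ /imsetP[t _ ->].
  by apply/imsetP; exists (q * t); rewrite ?mulgA.
have AB : #|A| <= #|B|.
  apply: leq_trans (leq_imset_card (fun b => r * b) B).
  apply/subset_leq_card/subsetP=> _ /imsetP[t _ ->].
  apply/imsetP; exists (e * q * (s * t)); last by rewrite -{1}rqs !mulgA.
  by apply: imset_f.
have /imsetP[t _ eE]: e \in B; last by exists t.
have /eqP-> : B == A by rewrite eqEcard BA.
by rewrite -{1}ee; apply: imset_f.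
Qed.

(** By stability applied to [e * f] and to [f * e], each of the two idempotents
is absorbed by the other. *)
Lemma commuting_idem_eq e f : e * e = e -> f * f = f -> e * f = f * e ->
  e \in J (e * f) -> f \in J (e * f) -> e = f.
Proof.
move=> ee ff ef /(idem_stable ee)[t et]; rewrite ef => /(idem_stable ff)[u fu].
have fe : f * e = e by rewrite {1}et ef !mulgA ff -ef -et.
by rewrite -fe -ef {1}fu -ef !mulgA ee ef -fu.
Qed.

(** The elements above a closed J-class form a subsemigroup: if [s] and [t] are
above [e], then [e = x * s * y = u * t * v] where [x * s] and [t * v] lie in the
class, hence so does [x * s * (t * v)], a multiple of [s * t].  Membership in
this subsemigroup is then a homomorphism to the two-element semilattice, which
has to be constant. *)
Lemma closed_jclass_min e : s_indecomposable S -> e * e = e ->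
  mulg_closed (jclass e) -> forall s, e \in J s.
Proof.
move=> indec ee eclosed.
pose f s : bool_meet := e \in J s.
have fM : {morph f : s t / s * t >-> s * t}.
  move=> s t; apply/idP/andP=> [est | [es et]].
    by split; apply: principal_ideal_trans est _;
      [apply: mulg_ideall | apply: mulg_idealr].
  have [x [y [xsy ex ye]]] := idem_above ee es.
  have [u [v [utv eu ve]]] := idem_above ee et.
  have xs_e : x * s \in jclass e.
    apply/jclassP; split; last by rewrite -xsy mulg_ideall.
    by rewrite -ex -mulgA mulg_ideall.
  have tv_e : t * v \in jclass e.
    apply/jclassP; split; last by rewrite -utv -mulgA mulg_idealr.
    by rewrite -ve mulgA mulg_idealr.
  have /jclassP[_] := eclosed _ _ xs_e tv_e.
  move/principal_ideal_trans; apply.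
  by rewrite !mulgA principal_idealMr // -mulgA mulg_idealr.
pose F := HB.pack_for {multiplicative S -> bool_meet} f
  (isMultiplicative.Build _ _ f fM).
move=> s; apply: contraT => es.
have [||c cE] := indec _ F.
- split; first exact: andbC.
  exact: andbb.
- by case; [exists e; rewrite /= /f mem_principal_ideal
            | exists s; apply: negbTE].
- by have := cE true; rewrite -(cE false).
Qed.

(** Let the class be made of [e] and [x].  As [x] is a product of an element of
[S * e] by one of [e * S], both in the class, one of them is [x], so that
[x * e = x] or [e * x = x].  In the second case [e = x * t] for some [t] in the
class, and either value of [t] determines all products: for [t = e] the class
is a right zero band, for [t = x] a group.  The first case is dual. *)
Lemma small_jclass_closed e : e * e = e -> #|jclass e| <= 2 ->
  mulg_closed (jclass e).
Proof.
move=> ee le2.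
have eJ : e \in jclass e by rewrite inE.
have [/existsP[x /andP[xJ xne]] | /existsPn only_e] :=
  boolP [exists x, (x \in jclass e) && (x != e)]; last first.
  suff J1 y : y \in jclass e -> y = e by move=> y z /J1-> /J1->; rewrite ee.
  by move=> yJ; apply/eqP; have:= only_e y; rewrite yJ /= negbK.
have J2 y : y \in jclass e -> y = e \/ y = x.
  move=> yJ; apply/pred2P; apply: contraTT le2; rewrite negb_or -ltnNge.
  case/andP=> yne ynx.
  have <- : #|y |: [set x; e]| = 3.
    by rewrite cardsU1 cards2 xne !inE negb_or ynx yne.
  by apply/subset_leq_card/subsetP=> t; rewrite !inE => /or3P[]/eqP->;
    rewrite ?eqxx //; move: xJ yJ; rewrite !inE.
have [xe ex] := jclassP _ _ xJ.
have [p [q [xpq pe eq]]] := idem_below ee xe.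
have [r [s [rxs er se]]] := idem_above ee ex.
have pJ : p \in jclass e.
  apply/jclassP; split; first by rewrite -pe mulg_idealr.
  by apply: principal_ideal_trans ex _; rewrite xpq mulg_ideall.
have qJ : q \in jclass e.
  apply/jclassP; split; first by rewrite -eq mulg_ideall.
  by apply: principal_ideal_trans ex _; rewrite xpq mulg_idealr.
have rJ : r \in jclass e.
  apply/jclassP; split; first by rewrite -er mulg_ideall.
  by rewrite -rxs -mulgA mulg_ideall.
have sJ : s \in jclass e.
  apply/jclassP; split; first by rewrite -se mulg_idealr.
  by rewrite -rxs mulg_idealr.
have xsJ : x * s \in jclass e.
  apply/jclassP; split; first by rewrite -se mulgA mulg_idealr.
  by rewrite -rxs -mulgA mulg_idealr.
have rxJ : r * x \in jclass e.
  apply/jclassP; split; first by rewrite -er -mulgA mulg_ideall.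
  by rewrite -rxs mulg_ideall.
suff [exJ xeJ xxJ] : [/\ e * x \in jclass e, x * e \in jclass e
                       & x * x \in jclass e].
  by move=> y z /J2[] -> /J2[] ->; rewrite ?ee.
have [xe_x | ex_x] : x * e = x \/ e * x = x.
- case: (J2 _ pJ) => pE; last by left; rewrite -pE.
  case: (J2 _ qJ) => qE; last by right; rewrite -qE.
  by rewrite xpq pE qE ee eqxx in xne.
- have [t tJ txe] : exists2 t, t \in jclass e & t * x = e.
    case: (J2 _ sJ) => sE; last by exists (r * x); rewrite // -{2}sE.
    by exists r; rewrite // -rxs sE -mulgA xe_x.
  rewrite xe_x; case: (J2 _ tJ) => tE; rewrite tE in txe.
    by rewrite txe; split=> //; rewrite -{1}xe_x -mulgA txe xe_x.
  by rewrite txe; split=> //; rewrite -txe -mulgA txe xe_x.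
- have [t tJ xte] : exists2 t, t \in jclass e & x * t = e.
    case: (J2 _ rJ) => rE; last by exists (x * s); rewrite // mulgA -{1}rE.
    by exists s; rewrite // -rxs rE ex_x.
  rewrite ex_x; case: (J2 _ tJ) => tE; rewrite tE in xte.
    by rewrite xte; split=> //; rewrite -{2}ex_x mulgA xte ex_x.
  by rewrite xte; split=> //; rewrite -xte mulgA xte ex_x.
Qed.

(** * Matrix units *)

(** The nonzero elements [(i, j)] of the Brandt semigroup over the index set
[I], realized inside one J-class, where falling out of the class stands for a
zero product; the units need not fill the class. *)
Definition matrix_units (I : finType) a (h : I -> I -> S) : Prop :=
  (forall i j, h i j \in jclass a) /\
  (forall i j k l, if j == k then h i j * h k l = h i l
                   else h i j * h k l \notin jclass a).

(** Choose [d i * c i = e] with [d i] in [e * S * u i] and [c i] in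
[u i * S * e]; the unit [(i, j)] is [c i * d j].  A product
[c i * d j * c k * d l] with [j != k] has [u j * u k] as a factor, which lies
strictly below [e] since [u j] and [u k] are distinct and commute. *)
Lemma matrix_units_exist (I : finType) (u : I -> S) e :
  e * e = e -> (forall i, u i \in jclass e) -> (forall i, u i * u i = u i) ->
  (forall i j, u i * u j = u j * u i) -> injective u ->
  exists h, @matrix_units I e h.
Proof.
move=> ee uJ uu uC u_inj.
have /fin_all_exists[pq pqP] i : exists pq : S * S,
    [/\ pq.1 * pq.2 = e, pq.1 * u i = pq.1, u i * pq.2 = pq.2, e * pq.1 = pq.1
      & pq.2 * e = pq.2].
  have /jclassP[_ eu] := uJ i.
  have [x [y [xuy ex ye]]] := idem_above ee eu.
  exists (x * u i, u i * y) => /=; split=> //.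
  - by rewrite !mulgA -(mulgA x) uu.
  - by rewrite -mulgA uu.
  - by rewrite mulgA uu.
  - by rewrite mulgA ex.
  - by rewrite -mulgA ye.
pose d i := (pq i).1; pose c i := (pq i).2.
exists (fun i j => c i * d j); split=> [i j | i j k l].
  have [dc _ _ _ ce] := pqP i; have [dc' _ _ ed _] := pqP j.
  apply/jclassP; split.
    by rewrite /c -ce -mulgA principal_idealMl // mulg_ideall.
  have -> : e = d i * (c i * d j) * c j by rewrite !mulgA dc -mulgA dc' ee.
  by rewrite principal_idealMr // mulg_idealr.
have [dc _ uc _ _] := pqP k; have [dc' du _ _ ce] := pqP j.
have [_ _ _ ed _] := pqP l.
case: eqP => [jk | jk].
  by rewrite !mulgA -(mulgA _ (d j)) jk dc -mulgA ed.
apply/negP=> /jclassP[_ e_below]; case: jk; apply: u_inj.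
have euu : e \in J (u j * u k).
  apply: principal_ideal_trans e_below _.
  rewrite /d /c -du -uc !mulgA principal_idealMr // principal_idealMr //.
  by rewrite -mulgA mulg_idealr.
have u_e m : u m \in J e by case/jclassP: (uJ m).
by apply: commuting_idem_eq => //; apply: principal_ideal_trans euu.
Qed.

Section MatrixUnits.

Variables (I : finType) (a : S) (h : I -> I -> S).
Hypothesis h_units : matrix_units a h.

Lemma matrix_units_mulM i j k : h i j * h j k = h i k.
Proof. by have := h_units.2 i j j k; rewrite eqxx. Qed.

Lemma matrix_units_mem_mul i j k l : (h i j * h k l \in jclass a) = (j == k).
Proof.
have := h_units.2 i j k l.
by case: eqP => [_ -> | _ /negbTE //]; apply: h_units.1.
Qed.

(** The product of [h i j] with [h j i] on either side stays in the J-class, and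
that of [h k l] does so only for matching indices. *)
Lemma matrix_units_inj i j k l : h i j = h k l -> i = k /\ j = l.
Proof.
move=> hE; split; apply/eqP.
  by rewrite -(matrix_units_mem_mul j i k l) -hE matrix_units_mem_mul.
by rewrite eq_sym -(matrix_units_mem_mul k l j i) -hE matrix_units_mem_mul.
Qed.

Lemma card_matrix_units : #|[set h p.1 p.2 | p : I * I]| = (#|I| * #|I|)%N.
Proof.
rewrite card_imset ?card_prod // => -[i j] [k l] /matrix_units_inj /=.
by case=> -> ->.
Qed.

Lemma matrix_units_sub : [set h p.1 p.2 | p : I * I] \subset jclass a.
Proof. by apply/subsetP=> _ /imsetP[p _ ->]; apply: h_units.1. Qed.

Lemma matrix_units_exhaust b :
  #|jclass a| = (#|I| * #|I|)%N -> b \in jclass a -> exists i j, b = h i j.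
Proof.
rewrite -card_matrix_units => cJ.
suff /eqP<- : [set h p.1 p.2 | p : I * I] == jclass a.
  by case/imsetP=> -[i j] _ ->; exists i, j.
by rewrite eqEcard matrix_units_sub cJ leqnn.
Qed.

End MatrixUnits.

(** The elements of B_2 other than its zero are the units indexed by 'I_2; here
they have to fill the J-class of [a]. *)
Definition full_B2_units a : Prop :=
  exists2 h : 'I_2 -> 'I_2 -> S, matrix_units a h
    & forall b, b \in jclass a -> exists i j, b = h i j.

(** * The principal factor isomorphic to B_2 *)

Lemma B2_mulE i j k l :
  (Some (i, j) : B2) * (Some (k, l) : B2) =
  if j == k then Some (i, l) else None.
Proof. by []. Qed.

Section Factor.

Variable a : S.
Local Notation pi := (\pi_(principal_factor a)%qT).

Definition in_ideal b (bJ : b \in J a) : principal_ideal_type a := exist _ b bJ.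

Lemma val_in_ideal b (bJ : b \in J a) : val (in_ideal bJ) = b.
Proof. by []. Qed.

Lemma pi_factorM (u v : principal_ideal_type a) : pi (u * v) = pi u * pi v.
Proof. exact: pi_principal_factor_mul. Qed.

Lemma pi_factorE (u v : principal_ideal_type a) :
  (pi u == pi v) =
  (u == v) || ((val u \in lower_ideal a) && (val v \in lower_ideal a)).
Proof. exact: eqmodE. Qed.

(** The coordinate map [g] sends a unit to its indices and the rest of the
principal ideal to the zero.  It is constant on the lower ideal, so it factors
through the principal factor. *)
Lemma full_units_isomorphic : full_B2_units a ->
  isomorphic (principal_factor a) B2.
Proof.
case=> h hU h_all.
pose g b : B2 := [pick ij | b == h ij.1 ij.2].
have g_h i j : g (h i j) = Some (i, j).
  rewrite /g; case: pickP => [[k l] /eqP /= | /(_ (i, j)) /=].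
    by case/(matrix_units_inj hU) => -> ->.
  by rewrite eqxx.
have g_low b : b \in lower_ideal a -> g b = None.
  rewrite lower_idealE /g => /andP[_ b_low].
  case: pickP => // -[i j] /eqP /= bE.
  by rewrite bE hU.1 in b_low.
have low_or b : b \in J a -> b \in lower_ideal a \/ exists i j, b = h i j.
  move=> bJ; case bj: (b \in jclass a); first by right; apply: h_all.
  by left; rewrite lower_idealE bJ bj.
have gM b c : b \in J a -> c \in J a -> g (b * c) = g b * g c.
  move=> /low_or[bl | [i [j ->]]].
    by move=> _; rewrite (g_low b) // g_low // lower_idealMr.
  move=> /low_or[cl | [k [l ->]]].
    by rewrite (g_low c) // g_low ?lower_idealMl // g_h.
  rewrite !g_h; have := hU.2 i j k l.
  rewrite B2_mulE; case: eqP => [_ -> // | _ hh].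
  rewrite g_low // lower_idealE hh andbT.
  by rewrite principal_idealMr // jclass_sub // hU.1.
pose f (q : principal_factor a) : B2 := g (val (repr q)).
have f_pi u : f (pi u) = g (val u).
  rewrite /f; have /eqP := reprK (pi u); rewrite pi_factorE.
  by case/orP=> [/eqP-> // | /andP[? ?]]; rewrite !g_low.
have fM : {morph f : p q / p * q >-> p * q}.
  elim/quotW=> u; elim/quotW=> v.
  by rewrite -pi_factorM !f_pi valM gM ?(valP u) ?(valP v).
exists (HB.pack_for {multiplicative principal_factor a -> B2} f
  (isMultiplicative.Build _ _ f fM)).
have hJ i j : h i j \in J a by apply/jclass_sub/hU.1.
(* A product of units with mismatched indices represents the zero. *)
have zJ : h ord0 ord0 * h ord_max ord0 \in J a by apply: principal_idealMr.
have zl : h ord0 ord0 * h ord_max ord0 \in lower_ideal a.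
  by rewrite lower_idealE zJ (matrix_units_mem_mul hU).
pose f' (w : B2) : principal_factor a :=
  if w is Some (i, j) then pi (in_ideal (hJ i j)) else pi (in_ideal zJ).
exists f' => [|[[i j]|]] /=; last 2 first.
- by rewrite f_pi val_in_ideal g_h.
- by rewrite f_pi val_in_ideal g_low.
elim/quotW=> u; rewrite f_pi; apply/eqP.
case: (low_or (val u) (valP u)) => [ul | [i [j uE]]].
  by rewrite g_low // pi_factorE val_in_ideal zl ul orbT.
by rewrite uE g_h pi_factorE -val_eqE val_in_ideal uE eqxx.
Qed.

(** The zero of [S] lies in the lower ideal of [a], so the elements of this
ideal are those that correspond to the zero of B_2.  The nonzero elements of
B_2 then come from single elements of the J-class, where equality in the
principal factor is equality in [S]. *)
Lemma isomorphic_full_units z : is_zero z -> a <> z ->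
  isomorphic (principal_factor a) B2 -> full_B2_units a.
Proof.
move=> z0 /eqP az [f [f' fK f'K]].
have zJ : z \in J a by have [<- _] := z0 a; apply: mulg_idealr.
have zl : z \in lower_ideal a.
  rewrite lower_idealE zJ; apply/jclassP=> -[_ /(zero_ideal z0)/eqP].
  by rewrite (negbTE az).
pose Z : principal_ideal_type a := in_ideal zJ.
have fZ : f (pi Z) = None.
  have Zw : f (pi Z) * None = f (pi Z).
    rewrite -(f'K None) -gmulfM; elim/quotW: (f' None) => u.
    rewrite -pi_factorM; congr (f (pi _)); apply: val_inj.
    by rewrite valM val_in_ideal; have [-> _] := z0 (val u).
  by move: Zw; case: (f (pi Z)) => [[i j]|].
have f_low u : (f (pi u) == None) = (val u \notin jclass a).
  rewrite -fZ (can_eq fK) pi_factorE val_in_ideal zl andbT lower_idealE.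
  rewrite (valP u) /=; case: eqP => [-> | //]; move: zl.
  by rewrite val_in_ideal lower_idealE => /andP[_ ->].
pose h i j : S := val (repr (f' (Some (i, j)))).
have pi_h i j : pi (repr (f' (Some (i, j)))) = f' (Some (i, j)).
  exact: reprK.
have hJ i j : h i j \in jclass a.
  have := f_low (repr (f' (Some (i, j)))).
  by rewrite pi_h f'K -/(h i j) => /esym/negbFE.
exists h.
  split=> // i j k l.
  have /(congr1 f) :=
    pi_factorM (repr (f' (Some (i, j)))) (repr (f' (Some (k, l)))).
  rewrite !pi_h gmulfM !f'K B2_mulE; case: eqP => [_ | _ /eqP].
    move/(congr1 f'); rewrite fK -pi_h => /eqP; rewrite pi_factorE.
    case/orP=> [/eqP/(congr1 val) | /andP[_]]; first by rewrite valM.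
    by rewrite -/(h i l) lower_idealE hJ andbF.
  by rewrite f_low valM.
move=> b bj; pose u : principal_ideal_type a := in_ideal (jclass_sub bj).
have := f_low u; rewrite val_in_ideal bj /=.
case fu: (f (pi u)) => [[i j]|//] _.
exists i, j; have /eqP : pi u = pi (repr (f' (Some (i, j)))).
  by rewrite pi_h -fu fK.
rewrite pi_factorE => /orP[/eqP/(congr1 val) // | /andP[]].
by rewrite val_in_ideal lower_idealE bj andbF.
Qed.

Lemma isomorphicP z : is_zero z -> a <> z ->
  isomorphic (principal_factor a) B2 <-> full_B2_units a.
Proof.
move=> z0 az.
by split; [apply: isomorphic_full_units z0 az | apply: full_units_isomorphic].
Qed.

End Factor.

(** * Commuting idempotents in one J-class *)

Section CommutingIdempotents.

Variables (a : S) (Y : {set S}).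
Hypotheses (YJ : Y \subset jclass a) (Yi : {in Y, forall x, x * x = x}).
Hypothesis Yc : {in Y &, forall x y, x * y = y * x}.

Lemma commuting_idem_matrix_units n : 0 < n -> #|Y| = n ->
  exists h : 'I_n -> 'I_n -> S, matrix_units a h.
Proof.
move=> n_gt0 cY.
have [e eY]: exists e, e \in Y by apply/card_gt0P; rewrite cY.
have eJ := jclass_eq (subsetP YJ e eY).
pose u (i : 'I_n) := enum_val (cast_ord (esym cY) i).
have uY i : u i \in Y by apply: enum_valP.
rewrite /matrix_units -eJ; apply: (matrix_units_exist (u := u)).
- exact: Yi.
- by move=> i; rewrite eJ (subsetP YJ).
- by move=> i; apply: Yi.
- by move=> i j; apply: Yc.
- by move=> i j /enum_val_inj /cast_ord_inj.
Qed.

Lemma card_commuting_idem : #|Y| * #|Y| <= #|jclass a|.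
Proof.
have [->//|Y_gt0] := posnP #|Y|.
have [h hU] := commuting_idem_matrix_units Y_gt0 erefl.
have := card_matrix_units hU; rewrite card_ord => <-.
exact: subset_leq_card (matrix_units_sub hU).
Qed.

(** [#|Y| ^ 2 <= #|jclass a|] settles every size of [Y] but one, which
[small_jclass_closed] covers. *)
Lemma open_jclass_bound : ~ mulg_closed (jclass a) ->
  2 * #|Y| <= #|jclass a| ?= iff (#|Y| == 2) && (#|jclass a| == 4).
Proof.
move=> a_open.
have c_gt0 := card_jclass_gt0 a.
have sqY := card_commuting_idem.
have c_ge3 : #|Y| = 1%N -> 2 < #|jclass a|.
  case/eqP/cards1P=> e Ye; rewrite ltnNge; apply/negP=> le2; apply: a_open.
  have eY : e \in Y by rewrite Ye set11.
  have eJ := jclass_eq (subsetP YJ e eY).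
  by rewrite -eJ in le2 *; apply: small_jclass_closed; rewrite ?Yi.
split; first by nia.
by apply/eqP/andP=> [? | [/eqP-> /eqP->] //]; split; apply/eqP; nia.
Qed.

(** Distinct commuting idempotents would have their product strictly below the
class. *)
Lemma closed_jclass_bound : s_indecomposable S -> mulg_closed (jclass a) ->
  Y = set0 \/ #|Y| = 1%N /\ forall s, a \in J s.
Proof.
move=> indec a_closed.
have [->|/set0Pn[e eY]] := eqVneq Y set0; [by left | right; split].
  apply/eqP; rewrite eqn_leq; apply/andP; split; last first.
    by apply/card_gt0P; exists e.
  apply/card_le1_eqP=> y x yY xY.
  have [[xJ yJ]] := (subsetP YJ x xY, subsetP YJ y yY).
  have [_ axy] := jclassP _ _ (a_closed _ _ xJ yJ).
  have [[xa _] [ya _]] := (jclassP _ _ xJ, jclassP _ _ yJ).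
  apply: (commuting_idem_eq (Yi xY) (Yi yY) (Yc xY yY)).
    exact: principal_ideal_trans xa axy.
  exact: principal_ideal_trans ya axy.
have eJ := jclass_eq (subsetP YJ e eY).
have e_min : forall s, e \in J s.
  by apply: closed_jclass_min; rewrite ?Yi // eJ.
have [_ ae] := jclassP _ _ (subsetP YJ e eY).
by move=> s; apply: principal_ideal_trans ae (e_min s).
Qed.

End CommutingIdempotents.

Lemma minimum_trivial_zero a :
  (forall s, a \in J s) -> #|jclass a| <= 1 -> is_zero a.
Proof.
move=> a_min /card_le1_eqP c1 s.
have J1 x : x \in J a -> x = a.
  by move=> xa; apply: c1; [rewrite inE | apply/jclassP].
by split; apply: J1; rewrite ?mulg_ideall ?mulg_idealr.
Qed.

(** * From a large subsemilattice to matrix units *)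

Lemma jclass_closed_or_open a :
  mulg_closed (jclass a) \/ ~ mulg_closed (jclass a).
Proof.
pose c := [forall x in jclass a, forall y in jclass a, x * y \in jclass a].
have cP : reflect (mulg_closed (jclass a)) c.
  apply: (iffP forall_inP) => [a_closed x y xJ yJ | a_closed x xJ].
    by have /forall_inP := a_closed x xJ; apply.
  by apply/forall_inP => y yJ; apply: a_closed.
by case: cP; [left | right].
Qed.

Section Subsemilattice.

Variable Y : {set S}.
Hypotheses (indec : s_indecomposable S) (Y_semi : subsemilattice Y).

Let YJ a := Y :&: jclass a.

Let YJ_sub a : YJ a \subset jclass a. Proof. exact: subsetIr. Qed.

Let YJi a : {in YJ a, forall x, x * x = x}.
Proof. by case: Y_semi => _ _ _ Yi x /setIP[/Yi]. Qed.

Let YJc a : {in YJ a &, forall x y, x * y = y * x}.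
Proof.
by case: Y_semi => _ _ Yc _ x y /setIP[xY _] /setIP[yY _]; apply: Yc.
Qed.

(** Only a closed J-class with a single element can fail the bound, and it is
the class of a zero. *)
Lemma jclass_bound a : ~ is_zero a -> 2 * #|YJ a| <= #|jclass a|.
Proof.
move=> a_nz; have [a_closed | a_open] := jclass_closed_or_open a; last first.
  by case: (open_jclass_bound (@YJ_sub a) (@YJi a) (@YJc a) a_open).
have := closed_jclass_bound (@YJ_sub a) (@YJi a) (@YJc a) indec a_closed.
case=> [-> | [-> a_min]]; first by rewrite cards0.
by rewrite muln1 ltnNge; apply/negP => /(minimum_trivial_zero a_min).
Qed.

(** In the presence of a zero, a closed J-class of a nonzero element misses [Y],
so there the inequality is strict. *)
Lemma jclass_bound_zero z a : is_zero z -> a != z ->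
  2 * #|YJ a| <= #|jclass a| ?= iff (#|YJ a| == 2) && (#|jclass a| == 4).
Proof.
move=> z0 az; have [a_closed | a_open] := jclass_closed_or_open a; last first.
  exact: open_jclass_bound (@YJ_sub a) (@YJi a) (@YJc a) a_open.
have c_gt0 := card_jclass_gt0 a.
have := closed_jclass_bound (@YJ_sub a) (@YJi a) (@YJc a) indec a_closed.
case=> [-> | [_ /(_ z) /(zero_ideal z0) a_z]]; last by rewrite a_z eqxx in az.
by split; rewrite cards0 // muln0 ltn_eqF.
Qed.

End Subsemilattice.

(** Summed over the J-classes, the bounds give [2 * #|Y| <= #|S|] without a zero
and [2 * #|Y| <= #|S| + 1] with one.  Equality in the latter forces equality at
each nonzero class. *)
Lemma B2_combinatorial_full_units : B2_combinatorial S ->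
  exists z : S, is_zero z /\ forall a, a <> z -> full_B2_units a.
Proof.
case=> indec [k cS] [Y Ysemi cY].
have {cY} cYS : (2 * #|Y| = #|S| + 1)%N by rewrite cY cS; lia.
pose Z I : {set S} := [set b in Y | J b == I].
pose C I : {set S} := [set b in [set: S] | J b == I].
have ZE a : Z (J a) = Y :&: jclass a by apply/setP=> b; rewrite !inE.
have CE a : C (J a) = jclass a by apply/setP=> b; rewrite !inE.
have {}cYS : (\sum_(I in [set J a | a : S]) 2 * #|Z I|
              = \sum_(I in [set J a | a : S]) #|C I| + 1)%N.
  by rewrite -big_distrr -!card_by_jclass cardsT.
have [/existsP[z /forallP z0] | /existsPn no_zero] :=
  boolP [exists z : S, forall x : S, (z * x == z) && (x * z == z)]; last first.
  suff : \sum_(I in [set J a | a : S]) 2 * #|Z I|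
         <= \sum_(I in [set J a | a : S]) #|C I| by rewrite cYS addn1 ltnn.
  apply: leq_sum => I /imsetP[a _ ->]; rewrite ZE CE; apply: jclass_bound => //.
  move=> a0; have /negP[] := no_zero a; apply/forallP=> x.
  by have [-> ->] := a0 x; rewrite !eqxx.
have {}z0 : is_zero z by move=> x; have /andP[/eqP ? /eqP ?] := z0 x.
have Jz : J z \in [set J a | a : S] by apply: imset_f.
have Jne a : a != z -> J a != J z.
  apply: contraNneq => Jaz; have: a \in jclass z by rewrite inE Jaz.
  by rewrite jclass_zero ?inE.
have bound I : (I \in [set J a | a : S]) && (I != J z) ->
    2 * #|Z I| <= #|C I| ?= iff (#|Z I| == 2) && (#|C I| == 4).
  case/andP=> /imsetP[a _ ->] az; rewrite ZE CE.
  apply: jclass_bound_zero z0 _ => //.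
  by apply: contra_neq az => ->.
have [le_sum eq_sum] := leqif_sum bound.
have mz : #|Z (J z)| <= 1.
  rewrite ZE jclass_zero // -(cards1 z).
  exact: subset_leq_card (subsetIr _ _).
have {}bound : forall a, a != z -> #|Y :&: jclass a| = 2 /\ #|jclass a| = 4.
  have /forallP Heq : [forall (I | (I \in [set J a | a : S]) && (I != J z)),
      (#|Z I| == 2) && (#|C I| == 4)].
    rewrite -eq_sum eqn_leq le_sum /=.
    move: cYS; rewrite (bigD1 (J z)) //= [in RHS](bigD1 (J z)) //=.
    rewrite CE jclass_zero // cards1; move: (#|Z (J z)|) mz.
    by move: (\sum_(i in _ | _) #|C i|) (\sum_(i in _ | _) (2 * _)%N); lia.
  move=> a az; have := Heq (J a); rewrite Jne // imset_f //= ZE CE.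
  by case/andP=> /eqP-> /eqP->.
exists z; split=> // a /eqP az; have [m2 c4] := bound a az.
have [|||h hU] :=
  @commuting_idem_matrix_units a (Y :&: jclass a) _ _ _ 2 isT m2.
- exact: subsetIr.
- by case: Ysemi => _ _ _ Yi x /setIP[/Yi].
- by case: Ysemi => _ _ Yc _ x y /setIP[xY _] /setIP[yY _]; apply: Yc.
exists h => // b; apply: (matrix_units_exhaust hU).
by rewrite c4 card_ord.
Qed.

(** * From matrix units to a large subsemilattice *)

Section Converse.

Variable z : S.
Hypothesis z0 : is_zero z.
Hypothesis units : forall a, a <> z -> full_B2_units a.

(** Among matrix units, [(i, i) * (k, k)] stays in the class only for
[i = k]. *)
Lemma jequiv_idem_eq e f : e * e = e -> f * f = f -> f \in jclass e ->
  e * f \in jclass e -> e = f.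
Proof.
move=> ee ff fe efe; have [ez|/eqP/units[h hU h_all]] := eqVneq e z.
  by move: fe; rewrite ez jclass_zero // => /set1P->.
have eJ : e \in jclass e by rewrite inE.
have [i [j eE]] := h_all _ eJ; have [k [l fE]] := h_all _ fe.
have mem_mul := matrix_units_mem_mul hU.
move: mem_mul eJ fe efe; move: (jclass e) => K mem_mul.
rewrite -{1}ee -{1}ff eE fE !mem_mul => /eqP-> /eqP <- /eqP->.
by [].
Qed.

Lemma inverse_exists a : exists b, a * b * a = a /\ b * a * b = b.
Proof.
have [->|/eqP/units[h hU h_all]] := eqVneq a z.
  by exists z; have [z1 _] := z0 z; rewrite !z1.
have [i [j ->]] : exists i j, a = h i j by apply: h_all; apply: jclass_refl.
by exists (h j i); rewrite !(matrix_units_mulM hU).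
Qed.

(** The idempotents [a * b] and [a * c] lie in the J-class of [a], and so does
their product [a * c]; hence they are equal.  So are [b * a] and [c * a]. *)
Lemma inverse_uniq a b c : a * b * a = a -> b * a * b = b ->
  a * c * a = a -> c * a * c = c -> b = c.
Proof.
move=> aba bab aca cac.
have idem x y : x * y * x = x -> x * y * (x * y) = x * y.
  by rewrite mulgA => ->.
have jE x y : x * y * x = x -> jclass (x * y) = jclass x.
  move=> xyx; apply/jclass_eq/jclassP.
  by split; [apply: mulg_ideall | rewrite -{1}xyx mulg_ideall].
have jE' x y : y * x * y = y -> jclass (x * y) = jclass y.
  move=> yxy; apply/jclass_eq/jclassP.
  by split; [apply: mulg_idealr | rewrite -{1}yxy -mulgA mulg_idealr].
have ab_ac : a * b = a * c.
  apply: jequiv_idem_eq; rewrite ?idem //.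
    by rewrite jE // -(jE a c) // jclass_refl.
  by rewrite mulgA aba jE // -(jE a c) // jclass_refl.
have ba_ca : b * a = c * a.
  apply: jequiv_idem_eq; rewrite ?idem //.
    by rewrite jE' // -(jE' c a) // jclass_refl.
  by rewrite mulgA -2!mulgA (mulgA a) aca jE' // -(jE' b a) // jclass_refl.
by rewrite -bab -mulgA ab_ac mulgA ba_ca cac.
Qed.

(** The classical argument for inverse semigroups: the inverse [w] of [x * y] is
also [y * w * x], hence is idempotent and equal to [x * y]; then [e * f] and
[f * e] are both inverse to [e * f]. *)
Lemma idem_commute e f : e * e = e -> f * f = f -> e * f = f * e.
Proof.
have dup x : x * x = x -> forall t, t * x * x = t * x.
  by move=> xx t; rewrite -mulgA xx.
have idemM x y : x * x = x -> y * y = y -> x * y * (x * y) = x * y.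
  move=> xx yy; have [w [xwx wxw]] := inverse_exists (x * y).
  have wr t : t * w * x * y * w = t * w by rewrite -[in RHS]wxw !mulgA.
  have wE : w = y * w * x.
    apply: (inverse_uniq xwx wxw); rewrite !mulgA (dup x) // (dup y) //.
      by rewrite !mulgA in xwx.
    by rewrite wr.
  have ww : w * w = w.
    have -> : w * w = y * w * x * (y * w * x) by rewrite -wE.
    by rewrite !mulgA wr -wE.
  by have <- : w = x * y by apply: (inverse_uniq _ _ wxw xwx); rewrite !ww.
move=> ee ff; have efef := idemM e f ee ff; have fefe := idemM f e ff ee.
rewrite !mulgA in efef fefe.
by apply: (@inverse_uniq (e * f)); rewrite !mulgA ?(dup e) ?(dup f) ?efef ?fefe.
Qed.

(** In a semilattice the images of J-equivalent elements coincide.  So [f a] is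
the image of [(0, 0) * (1, 1)], which generates a smaller ideal, and the value
at the zero is reached by descent. *)
Lemma full_units_indecomposable : s_indecomposable S.
Proof.
move=> T f [TC Ti] f_onto; exists (f z).
suff fz a : f a = f z by move=> t; have [a <-] := f_onto t; apply: fz.
have [n] := ubnP #|J a|; elim: n a => // n IHn a; rewrite ltnS => cJ.
have [->//|/eqP/units[h hU h_all]] := eqVneq a z.
have f_h i j k l : f (h i j) = f (h k l).
  have abs i' j' k' l' : f (h i' j') * f (h k' l') = f (h i' j').
    have -> : f (h i' j') = f (h i' k') * f (h k' l') * f (h l' j').
      by rewrite -!gmulfM !(matrix_units_mulM hU).
    by rewrite -mulgA (TC (f (h l' j'))) mulgA -(mulgA (f (h i' k'))) Ti.
  by rewrite -(abs i j k l) TC abs.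
have [i [j aE]]: exists i j, a = h i j by apply: h_all; apply: jclass_refl.
pose b := h ord0 ord0 * h ord_max ord_max.
have -> : f a = f b.
  by rewrite aE /b gmulfM (f_h ord_max ord_max ord0 ord0) Ti.
apply: IHn; apply: leq_trans cJ; apply: proper_card.
have bJ : b \in J a by apply: principal_idealMr; apply: jclass_sub (hU.1 _ _).
rewrite properEneq principal_idealS // andbT.
by have := matrix_units_mem_mul hU ord0 ord0 ord_max ord_max; rewrite inE => ->.
Qed.

Lemma card_jclass_idem a : a != z ->
  #|jclass a| = 4 /\ #|[set e in jclass a | e * e == e]| = 2.
Proof.
move=> /eqP/units[h hU h_all].
have hJ : jclass a = [set h p.1 p.2 | p : 'I_2 * 'I_2].
  apply/eqP; rewrite eqEsubset (matrix_units_sub hU) andbT.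
  by apply/subsetP=> b /h_all[i [j ->]]; apply/imsetP; exists (i, j).
split; first by rewrite hJ (card_matrix_units hU) card_ord.
have -> : [set e in jclass a | e * e == e] = [set h i i | i : 'I_2].
  apply/setP=> e; rewrite inE; apply/andP/imsetP => [[eJ /eqP ee] | [i _ ->]].
    have [i [j eE]] := h_all e eJ; exists i => //.
    have /eqP ji: j == i by rewrite -(matrix_units_mem_mul hU i j i j) -eE ee.
    by rewrite eE ji.
  by rewrite hU.1 (matrix_units_mulM hU).
by rewrite card_imset ?card_ord // => i j /(matrix_units_inj hU)[].
Qed.

(** Counting along J-classes: if there are [k] nonzero ones, [S] has
[1 + 4 * k] elements and [1 + 2 * k] idempotents. *)
Lemma full_units_B2_combinatorial : B2_combinatorial S.
Proof.
pose E := [set e : S | e * e == e].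
pose K := [set J a | a : S] :\ J z.
have zE : z \in E by rewrite inE; have [-> _] := z0 z.
have classE Y a : [set b in Y | J b == J a] = Y :&: jclass a.
  by apply/setP=> b; rewrite !inE.
have count Y m n : #|Y :&: [set z]| = m ->
    (forall a, a != z -> #|Y :&: jclass a| = n) -> #|Y| = m + #|K| * n.
  move=> Ym Yn; rewrite card_by_jclass (big_setD1 (J z)) ?imset_f //=.
  rewrite classE jclass_zero // Ym; congr addn.
  rewrite -sum_nat_const; apply: eq_bigr => I /setD1P[Iz /imsetP[a _ IE]].
  by rewrite IE classE; apply: Yn; apply: contraNneq Iz => <-; rewrite IE.
have cS : #|S| = 1 + #|K| * 4.
  rewrite -cardsT; apply: count; first by rewrite setTI cards1.
  by move=> a az; rewrite setTI; case: (card_jclass_idem az).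
have cE : #|E| = 1 + #|K| * 2.
  apply: count; first by rewrite (setIidPr _) ?cards1 ?sub1set.
  move=> a az; have [_ <-] := card_jclass_idem az.
  by congr #|pred_of_set _|; apply/setP=> e; rewrite !inE andbC.
split; first exact: full_units_indecomposable.
- by exists #|K|; rewrite cS; lia.
- exists E; last by rewrite cE cS; lia.
  split; first by apply/set0Pn; exists z.
  + move=> e f; rewrite !inE => /eqP ee /eqP ff.
    by rewrite mulgA -(mulgA e) -(idem_commute ee ff) mulgA ee -mulgA ff.
  + by move=> e f; rewrite !inE => /eqP ee /eqP ff; apply: idem_commute.
  + by move=> e; rewrite inE => /eqP.
Qed.

End Converse.

End FiniteSemigroup.

Theorem theorem6p5 (S : finSemigroupType) (S_nonempty : 0 < #|S|) :
  B2_combinatorial S <->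
  exists z : S, is_zero z /\
    forall a : S, a <> z -> isomorphic (principal_factor a) B2.
Proof.
split=> [/B2_combinatorial_full_units[z [z0 units]] | [z [z0 isoB2]]].
  by exists z; split=> // a az; apply/(isomorphicP z0 az)/units.
apply: (full_units_B2_combinatorial z0) => a az.
exact/(isomorphicP z0 az)/isoB2.
Qed.
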